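(* Let $K$ and $L$ be compact spaces. Assume there exists a continuous linear map $\phi:C_p(K)\to C_p(L)$ such that $\phi(C_p(K))$ is dense in $C_p(L)$. If $K$ is $\omega$-Corson compact, then $L$ is $\omega$-Corson compact as well.
   Context: All topological spaces are Tychonoff (completely regular Hausdorff). $C_p(X)$ is the space of real-valued continuous functions on $X$ with the topology of pointwise convergence. A compact space is $\omega$-Corson compact if, for some set $\Gamma$, it is homeomorphic to a subset of $\Sigma_\omega(\mathbb{R}^\Gamma)=\{x\in\mathbb{R}^\Gamma:\{\gamma\in\Gamma:x(\gamma)\neq0\}\text{ is finite}\}$, with the subspace topology from the product $\mathbb{R}^\Gamma$. *)

(* Defs.v *)
From HB Require Import structures.
From mathcomp Require Import all_boot all_order all_algebra.
From mathcomp Require Import all_classical all_reals all_analysis.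

Set Implicit Arguments.
Unset Strict Implicit.
Unset Printing Implicit Defensive.

Import Order.TTheory GRing.Theory Num.Theory.
Import numFieldNormedType.Exports.

Local Open Scope classical_set_scope.
Local Open Scope ring_scope.

Definition tychonoff_space (T : topologicalType) :=
  completely_regular_space T /\ hausdorff_space T.

Definition homeomorphic (S T : topologicalType) :=
  exists (f : S -> T) (g : T -> S),
    [/\ continuous f, continuous g, cancel f g & cancel g f].

(* An alias of [continuousType X R], so that the topology of pointwise
   convergence does not compete with the other topologies that the library
   can put on [continuousType X R]. *)
Definition Cp (R : realType) (X : topologicalType) : Type := continuousType X R.

Section Cp_topology.
Variables (R : realType) (X : topologicalType).

Definition Cp_fun (f : Cp R X) : {ptws X -> R} :=
  (f : continuousType X R) : X -> R.

HB.instance Definition _ := Choice.copy (Cp R X) (continuousType X R).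
HB.instance Definition _ :=
  Topological.copy (Cp R X) (initial_topology Cp_fun).

End Cp_topology.

Section Cp_lmodule.
Variables (R : realType) (X : topologicalType).
Implicit Types (f g h : Cp R X) (a b : R).

Let fn f : X -> R := Cp_fun f.

Lemma Cp_fun_inj : injective (@Cp_fun R X).
Proof. by move=> f g fg; apply/continuousEP => x; exact: (congr1 (@^~ x) fg). Qed.

Lemma Cp_fun_continuous f : continuous (fn f).
Proof. exact: (@cts_fun _ _ (f : continuousType X R)). Qed.

Let cts0 : continuous (fun _ : X => 0 : R).
Proof. by move=> x; exact: cvg_cst. Qed.

Let ctsN f : continuous (fun x => - fn f x).
Proof. by move=> x; apply: cvgN; exact: Cp_fun_continuous. Qed.

Let ctsD f g : continuous (fun x => fn f x + fn g x).
Proof. by move=> x; apply: cvgD; exact: Cp_fun_continuous. Qed.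

Let ctsZ a f : continuous (fun x => a * fn f x).
Proof. by move=> x; apply: cvgM; [exact: cvg_cst|exact: Cp_fun_continuous]. Qed.

Definition Cp_zero : Cp R X := @mkcts _ _ _ cts0.
Definition Cp_opp f : Cp R X := @mkcts _ _ _ (@ctsN f).
Definition Cp_add f g : Cp R X := @mkcts _ _ _ (@ctsD f g).
Definition Cp_scale a f : Cp R X := @mkcts _ _ _ (@ctsZ a f).

Let addA : associative Cp_add.
Proof. by move=> f g h; apply/Cp_fun_inj/funext => x; exact: addrA. Qed.

Let addC : commutative Cp_add.
Proof. by move=> f g; apply/Cp_fun_inj/funext => x; exact: addrC. Qed.

Let add0 : left_id Cp_zero Cp_add.
Proof. by move=> f; apply/Cp_fun_inj/funext => x; exact: add0r. Qed.

Let addN : left_inverse Cp_zero Cp_opp Cp_add.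
Proof. by move=> f; apply/Cp_fun_inj/funext => x; exact: addNr. Qed.

HB.instance Definition _ := GRing.isZmodule.Build (Cp R X) addA addC add0 addN.

Let scaleA a b f : Cp_scale a (Cp_scale b f) = Cp_scale (a * b) f.
Proof. by apply/Cp_fun_inj/funext => x; exact: mulrA. Qed.

Let scale1 : left_id 1 Cp_scale.
Proof. by move=> f; apply/Cp_fun_inj/funext => x; exact: mul1r. Qed.

Let scaleDr : right_distributive Cp_scale +%R.
Proof. by move=> a f g; apply/Cp_fun_inj/funext => x; exact: mulrDr. Qed.

Let scaleDl f : {morph Cp_scale^~ f : a b / a + b}.
Proof. by move=> a b; apply/Cp_fun_inj/funext => x; exact: mulrDl. Qed.

HB.instance Definition _ :=
  GRing.Zmodule_isLmodule.Build R (Cp R X) scaleA scale1 scaleDr scaleDl.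

End Cp_lmodule.

Definition Sigma_omega (R : realType) (Gamma : Type) : set {ptws Gamma -> R} :=
  [set x | finite_set [set gamma | x gamma != 0]].

(* [A], coerced to a type, carries the subspace topology. *)
Definition omega_Corson_compact (R : realType) (T : topologicalType) :=
  compact [set: T] /\
  exists (Gamma : Type) (A : set {ptws Gamma -> R}),
    A `<=` @Sigma_omega R Gamma /\ homeomorphic T A.

(* Main.v *)
(* For y in L the functional h |-> phi h y is a finite combination mu_y of point
   evaluations on K, and y |-> mu_y is injective because phi has dense range.
   Let (f_g) be a point-finite separating family of continuous functions on K,
   let f_w be the product of the f_g over the letters g of a word w, and let
   M_w y = mu_y (f_w) = phi f_w y, which is continuous in y.
   For words w_1, ..., w_m of length at most m, the Hankel-like determinant
   D y = det (M_(w_i w_j) y) is nonzero only if mu_y has at least m atoms and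
   all letters of the w_i are nonzero somewhere on its support; if mu_y has
   exactly m atoms then some choice of the w_i gives D y != 0. Since a measure
   with n atoms is determined, among those with at most n atoms, by its moments
   M_w with w of length at most 2n, the functions D and D * M_w, with w of
   length at most 2m, form a point-finite separating family on L. The bounds
   on the lengths in terms of m are what makes the family point-finite. *)
Require Import Defs.
From mathcomp Require Import all_boot all_order all_algebra.
From mathcomp Require Import all_classical all_reals all_analysis.
From mathcomp Require Import perm ring.

Set Implicit Arguments.
Unset Strict Implicit.
Unset Printing Implicit Defensive.

Import Order.TTheory GRing.Theory Num.Theory.
Import numFieldNormedType.Exports.

Local Open Scope classical_set_scope.
Local Open Scope ring_scope.

(** * Pointwise topology and embeddings of compact spaces *)

Lemma ptws_eval_continuous (I : Type) (T : topologicalType) (i : I) :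
  continuous (fun f : {ptws I -> T} => f i).
Proof. exact: (@proj_continuous {classic I} (fun=> T) i). Qed.

Lemma ptws_cvg (I : Type) (T : topologicalType) (F : set_system {ptws I -> T})
    (g : {ptws I -> T}) : Filter F ->
  (forall i, f i @[f --> F] --> g i) -> F --> g.
Proof.
move=> FF Fg; apply/cvg_sup => i; apply/cvg_image.
  by apply/seteqP; split=> // v _; exists (cst v).
move=> A /Fg FA; exists ((fun f : {ptws I -> T} => f i) @^-1` A) => //.
by apply: image_preimage; apply/seteqP; split=> // v _; exists (cst v).
Qed.

Lemma ptws_continuous (X : topologicalType) (I : Type) (T : topologicalType)
    (f : X -> {ptws I -> T}) :
  (forall i, continuous (fun x => f x i)) -> continuous f.
Proof. by move=> fc x; apply: ptws_cvg => i; exact: fc. Qed.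

Lemma ptws_hausdorff (I : Type) (T : topologicalType) :
  hausdorff_space T -> hausdorff_space {ptws I -> T}.
Proof. by move=> hT; exact: (@hausdorff_product {classic I} (fun=> T)). Qed.

(** The inverse is continuous because closed sets of [X] are compact, so their images are compact,
    hence closed in [Y]. *)
Lemma compact_homeomorphic_range (X Y : topologicalType) (f : X -> Y) :
  compact [set: X] -> hausdorff_space Y -> continuous f -> injective f ->
  homeomorphic X (range f).
Proof.
move=> cptX hY fc fI.
pose h (x : X) : range f := SigSub (mem_set (imageT f x)).
have hK y : {x | h x = y}.
  apply: cid; have [x _ fx] := set_valP y; exists x.
  exact: val_inj.
exists h, (fun y => sval (hK y)); split.
- by apply: continuous_comp_initial; exact: fc.
- apply/continuous_closedP => A clA.
  have clfA : closed (f @` A).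
    apply: (compact_closed hY); apply: continuous_compact.
      exact: continuous_subspaceT.
    exact: subclosed_compact clA cptX _.
  pose v : range f -> Y := set_val.
  suff -> : (fun y => sval (hK y)) @^-1` A = v @^-1` (f @` A).
    by have /continuous_closedP := @initial_continuous _ _ v; exact.
  apply/seteqP; split=> y /=; case: (hK y) => x /= <-.
    by exists x.
  by case=> z Az /fI <-.
- by move=> x; case: (hK (h x)) => z /= /(congr1 val) /fI.
- by move=> y; case: (hK y).
Qed.

(** * Omega-Corson compactness through point-finite separating families *)

Section point_finite_families.
Variables (R : realType) (T : topologicalType).

Lemma omega_Corson_compact_family (I : Type) (f : I -> T -> R) :
  compact [set: T] -> (forall i, continuous (f i)) ->
  (forall x, finite_set [set i | f i x != 0]) ->
  (forall x y, (forall i, f i x = f i y) -> x = y) ->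
  omega_Corson_compact R T.
Proof.
move=> cptT fc ffin fsep; split=> //.
pose F (x : T) : {ptws I -> R} := f^~ x.
exists I, (range F); split; first by move=> _ [x _ <-]; exact: ffin.
apply: compact_homeomorphic_range => //.
- exact/ptws_hausdorff/Rhausdorff.
- by apply: ptws_continuous => i; exact: fc.
- by move=> x y Fxy; apply: fsep => i; exact: (congr1 (@^~ i) Fxy).
Qed.

Lemma omega_Corson_compact_coordinates : omega_Corson_compact R T ->
  exists (I : choiceType) (f : I -> T -> R),
    [/\ forall i, continuous (f i),
        forall x, finite_set [set i | f i x != 0] &
        forall x y, (forall i, f i x = f i y) -> x = y].
Proof.
move=> [_ [Gamma [A [A_fin [f [g [fc gc fK gK]]]]]]].
(* The classical choice structure on [Gamma] lets the indices serve as letters of words. *)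
exists {classic Gamma}, (fun i x => (set_val (f x) : {ptws Gamma -> R}) i).
split.
- move=> i x; apply: (@continuous_comp _ _ _ f
    (fun a : A => (set_val a : {ptws Gamma -> R}) i)); first exact: fc.
  apply: (@continuous_comp _ _ _ (set_val : A -> {ptws Gamma -> R})
    (fun a : {ptws Gamma -> R} => a i)); first exact: initial_continuous.
  exact: ptws_eval_continuous.
- by move=> x; apply: A_fin; exact: set_valP.
- move=> x y fxy; apply: (can_inj fK); apply: val_inj.
  by apply: funext => i; exact: fxy.
Qed.

End point_finite_families.

(** * Continuous linear functionals as finite combinations of evaluations *)

Section Cp_functionals.
Variables (R : realType) (X : topologicalType).

Lemma Cp_eval_continuous (x : X) : continuous (fun f : Cp R X => Cp_fun f x).
Proof.
move=> f; apply: (@continuous_comp _ _ _ (@Cp_fun R X)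
  (fun h : {ptws X -> R} => h x)); first exact: initial_continuous.
exact: ptws_eval_continuous.
Qed.

Lemma Cp_cvg (F : set_system (Cp R X)) (g : Cp R X) : Filter F ->
  (forall x, Cp_fun f x @[f --> F] --> Cp_fun g x) -> F --> g.
Proof.
move=> FF Fg; have {}Fg : Cp_fun f @[f --> F] --> Cp_fun g by exact: ptws_cvg.
move=> U [_ [[B Bop <-] Bg BU]]; apply: (filterS BU); apply: Fg.
by rewrite nbhsE; exists B.
Qed.

Lemma Cp_sumE (s : seq X) (a : X -> R) (e : X -> Cp R X) (x : X) :
  Cp_fun (\sum_(z <- s) a z *: e z) x = \sum_(z <- s) a z * Cp_fun (e z) x.
Proof.
by elim: s => [|z s IHs]; rewrite ?big_nil// !big_cons -IHs.
Qed.

Hypothesis tychX : tychonoff_space X.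

Lemma Cp_separate_finite (s : seq X) (x : X) : x \notin s ->
  exists e : Cp R X, Cp_fun e x = 1 /\ forall y, y \in s -> Cp_fun e y = 0.
Proof.
case: tychX => crX hX xs.
have cls : closed [set` s].
  exact: (accessible_finite_set_closed.1 (hausdorff_accessible hX)).
have /(@uniform_separatorP _ R)[u [uc _ u0 u1]] := crX x _ cls (negP xs).
have vc : continuous (fun y => 1 - u y).
  by move=> y; apply: cvgB; [exact: cvg_cst|exact: uc].
exists (@mkcts _ _ _ vc : continuousType X R); split=> [|y ys].
  by rewrite /Cp_fun /= /mkcts (u0 (u x)) ?subr0//; exists x.
by rewrite /Cp_fun /= /mkcts (u1 (u y)) ?subrr//; exists y.
Qed.

Variable psi : Cp R X -> R.
Hypotheses (psi_scalar : scalar psi) (psi_cont : continuous psi).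

Let psi0 : psi 0 = 0.
Proof. by have := psi_scalar (-1) 0 0; rewrite scaleN1r addNr mulN1r addNr. Qed.

Let psiZ a f : psi (a *: f) = a * psi f.
Proof. by have := psi_scalar a f 0; rewrite addr0 psi0 addr0. Qed.

Let psiD f g : psi (f + g) = psi f + psi g.
Proof. by have := psi_scalar 1 f g; rewrite scale1r mul1r. Qed.

Let psi_sum (s : seq X) (a : X -> R) (e : X -> Cp R X) :
  psi (\sum_(z <- s) a z *: e z) = \sum_(z <- s) a z * psi (e z).
Proof.
elim: s => [|z s IHs]; first by rewrite !big_nil.
by rewrite !big_cons psiD psiZ IHs.
Qed.

(* The sets of functions vanishing on a given finite set form a filter base
   converging to 0 in Cp, so psi is bounded by 1, hence by linearity is null,
   on one of them. *)
Lemma Cp_functional_finite_carrier :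
  exists s : seq X,
    forall f, (forall x, x \in s -> Cp_fun f x = 0) -> psi f = 0.
Proof.
pose B (s : seq X) := [set f : Cp R X | forall x, x \in s -> Cp_fun f x = 0].
have FB : Filter (filter_from setT B).
  apply: filter_from_filter; first by exists [::].
  move=> s t _ _; exists (s ++ t) => // f fst.
  by split=> x xs; apply: fst; rewrite mem_cat xs ?orbT.
have F0 : filter_from setT B --> (0 : Cp R X).
  apply: Cp_cvg => x U /nbhs_singleton U0; exists [:: x] => // f.
  by move=> /(_ x (mem_head _ _)) /= ->.
have := cvg_trans (cvg_app psi F0) (@psi_cont 0).
rewrite psi0 => /(_ _ (nbhsx_ballx 0 1 ltr01))[s _ sB].
exists s => f fs; apply/eqP/negPn/negP => psif.
have /sB /= : B s ((psi f)^-1 *: f).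
  move=> x xs; transitivity ((psi f)^-1 * Cp_fun f x) => //.
  by rewrite fs// mulr0.
by rewrite psiZ mulVf// /ball /= sub0r normrN normr1 ltxx.
Qed.

(** On a finite carrier, [psi] is computed by interpolation. Keeping only nonzero weights makes [s],
    up to order, and [c] determined by [psi]. *)
Lemma Cp_functional_finite_support :
  exists (s : seq X) (c : X -> R),
    [/\ uniq s, forall x, (x \in s) = (c x != 0) &
    forall f, psi f = \sum_(x <- s) c x * Cp_fun f x].
Proof.
have [t0 t0P] := Cp_functional_finite_carrier.
pose t := undup t0.
have tP f : (forall x, x \in t -> Cp_fun f x = 0) -> psi f = 0.
  by move=> ft; apply: t0P => x xt0; apply: ft; rewrite mem_undup.
have /choice[e eP] (x : X) : exists e : Cp R X,
    Cp_fun e x = 1 /\ forall y, y \in rem x t -> Cp_fun e y = 0.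
  by apply: Cp_separate_finite; rewrite mem_rem_uniqF ?undup_uniq.
have e_delta x y : y \in t -> Cp_fun (e x) y = (y == x)%:R.
  have [e1 e0] := eP x; case: eqVneq => [-> _|yx yt]; first exact: e1.
  by rewrite e0// mem_rem_uniq ?undup_uniq// inE yx.
pose c x := if x \in t then psi (e x) else 0.
exists [seq x <- t | c x != 0], c; split.
- by rewrite filter_uniq ?undup_uniq.
- move=> x; rewrite mem_filter /c.
  by case: (x \in t); rewrite ?andbT ?andbF ?eqxx.
move=> f; rewrite big_filter big_mkcond/=.
(* [f] and its interpolant agree on the carrier [t], so [psi] does not distinguish them. *)
have -> : psi f = psi (\sum_(x <- t) Cp_fun f x *: e x).
  apply/eqP; rewrite -subr_eq0 -mulN1r -psiZ scaleN1r -psiD.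
  apply/eqP/tP => y yt.
  have CpB (g h : Cp R X) : Cp_fun (g - h) y = Cp_fun g y - Cp_fun h y by [].
  rewrite CpB Cp_sumE (bigD1_seq y) ?undup_uniq//= e_delta// eqxx mulr1.
  rewrite big1_seq.
    by rewrite addr0 subrr.
  by move=> x /andP[xy xt]; rewrite e_delta// eq_sym (negPf xy) mulr0.
rewrite psi_sum; apply: eq_big_seq => x xt; rewrite /c xt mulrC.
by case: eqVneq => [->|//]; rewrite mul0r.
Qed.

End Cp_functionals.

(** * Words and moments of finitely supported measures *)

Lemma finite_set_bounded_seqs (T : choiceType) (B : set T) (n : nat) :
  finite_set B ->
  finite_set [set w : seq T | (size w <= n)%N /\ forall g, g \in w -> B g].
Proof.
move=> finB; elim: n => [|n IHn].
  by apply: (@sub_finite_set _ _ [set [::]]) => // -[|g w] [].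
apply: (@sub_finite_set _ _ ([set [::]] `|` [set g :: w | g in B & w in
  [set w : seq T | (size w <= n)%N /\ forall g, g \in w -> B g]])).
  move=> [|g w] [wn wB]; [by left|right].
  exists g; first by apply: wB; rewrite mem_head.
  by exists w => //; split=> // h hw; apply: wB; rewrite in_cons hw orbT.
by rewrite finite_setU; split; [exact: finite_set1|exact: finite_image2].
Qed.

Section moments.
Variables (F : fieldType) (Gamma X : choiceType) (f : Gamma -> X -> F).

Definition word_eval (w : seq Gamma) (x : X) : F := \prod_(g <- w) f g x.

Definition moment (s : seq X) (c : X -> F) (w : seq Gamma) : F :=
  \sum_(x <- s) c x * word_eval w x.

Definition moment_det (M : seq Gamma -> F) (W : seq (seq Gamma)) : F :=
  \det (\matrix_(i < size W, j < size W) M (nth [::] W i ++ nth [::] W j)).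

Lemma word_eval_eq0 w x : word_eval w x != 0 -> forall g, g \in w -> f g x != 0.
Proof.
move=> wx g gw; apply: contraNneq wx => fgx.
by rewrite /word_eval prodf_seq_eq0; apply/hasP; exists g; rewrite ?fgx /=.
Qed.

Lemma word_eval_cat v w x :
  word_eval (v ++ w) x = word_eval v x * word_eval w x.
Proof. exact: big_cat. Qed.

Lemma moment_neq0 s c w : moment s c w != 0 ->
  exists2 x, x \in s & forall g, g \in w -> f g x != 0.
Proof.
move=> Mw; apply: contrapT => /forall2NP sw; move/negP: Mw; apply; apply/eqP.
apply: big1_seq => x /= xs.
have [->|/word_eval_eq0 wx] := eqVneq (word_eval w x) 0.
  exact: mulr0.
by have [] := sw x.
Qed.

(** A Vandermonde-like matrix. The row count [m] is independent of [size W], so that the matrix can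
    be square by its type. *)
Definition word_matrix m (W : seq (seq Gamma)) (s : seq X) :
    'M[F]_(m, size s) :=
  \matrix_(i, j) word_eval (nth [::] W i) (tnth (in_tuple s) j).

(** Evaluation turns concatenation into a product, whence the factorization V diag(c) V^T. *)
Lemma moment_matrixE m W s c :
  \matrix_(i < m, j < m) moment s c (nth [::] W i ++ nth [::] W j) =
  word_matrix m W s *m diag_mx (\row_j c (tnth (in_tuple s) j))
    *m (word_matrix m W s)^T.
Proof.
apply/matrixP => i j; rewrite mul_mx_diag !mxE /moment big_tnth.
by apply: eq_bigr => k _; rewrite !mxE word_eval_cat mulrCA mulrA mulrC mulrA.
Qed.

(** An invertible moment matrix factors through dimension [size s], which bounds its rank. *)
Lemma moment_det_size s c W : moment_det (moment s c) W != 0 ->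
  (size W <= size s)%N.
Proof.
rewrite /moment_det moment_matrixE -unitfE -unitmxE -row_free_unit => /eqP <-.
rewrite -mulmxA; apply: leq_trans (mxrankM_maxl _ _) _; exact: rank_leq_col.
Qed.

(** A letter null on [s] would make the whole row of its word zero. *)
Lemma moment_det_letters s c W : moment_det (moment s c) W != 0 ->
  forall w g, w \in W -> g \in w -> exists2 x, x \in s & f g x != 0.
Proof.
move=> DW w g wW gw; apply: contrapT => /forall2NP sg.
move/negP: DW; apply; apply/eqP.
have iW : (index w W < size W)%N by rewrite index_mem.
rewrite /moment_det (expand_det_row _ (Ordinal iW)) big1// => j _.
rewrite mxE /= nth_index// (_ : moment _ _ _ = 0) ?mul0r//.
apply/eqP/negPn/negP => /moment_neq0[x xs /(_ g)].
rewrite mem_cat gw => /(_ isT).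
by have [] := sg x.
Qed.

Hypothesis f_sep : forall x y, (forall g, f g x = f g y) -> x = y.

(** One factor per point of [t]; this count yields the length bounds on words below. *)
Lemma separating_product x (t : seq X) : x \notin t ->
  exists ps : seq (Gamma * F), [/\ size ps = size t,
    \prod_(p <- ps) (f p.1 x - p.2) != 0 &
    forall y, y \in t -> \prod_(p <- ps) (f p.1 y - p.2) = 0].
Proof.
elim: t => [_|y t IHt]; first by exists [::]; rewrite big_nil oner_neq0.
rewrite in_cons negb_or => /andP[xy /IHt[ps [szps psx pst]]].
have /existsNP[g gxy] : ~ forall g, f g x = f g y.
  by move=> /f_sep /eqP; rewrite (negPf xy).
exists ((g, f g y) :: ps); split=> [||z].
- by rewrite /= szps.
- by rewrite big_cons mulf_neq0//= subr_eq0; apply/eqP.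
- rewrite in_cons big_cons => /predU1P[->|/pst ->]; last exact: mulr0.
  by rewrite /= subrr mul0r.
Qed.

Lemma moments_eq0 s c : uniq s ->
  (forall w, (size w <= size s)%N -> moment s c w = 0) ->
  forall x, x \in s -> c x = 0.
Proof.
move=> us Ms.
(* Expanding a factor [f g x - a] gives the sum for [g :: w] minus [a] times the sum for [w]; word
   length plus number of factors stays at most [size s]. *)
have Mps (ps : seq (Gamma * F)) w : (size w + size ps <= size s)%N ->
    \sum_(x <- s) c x * (word_eval w x * \prod_(p <- ps) (f p.1 x - p.2)) = 0.
  elim: ps w => [|[g a] ps IHps] w /=.
    rewrite addn0 => /Ms Mw; rewrite -[RHS]Mw; apply: eq_bigr => x _.
    by rewrite big_nil mulr1.
  rewrite addnS => wps.
  transitivity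
    (\sum_(x <- s)
        c x * (word_eval (g :: w) x * \prod_(p <- ps) (f p.1 x - p.2))
     - a * \sum_(x <- s)
        c x * (word_eval w x * \prod_(p <- ps) (f p.1 x - p.2))).
    rewrite mulr_sumr -sumrB; apply: eq_bigr => x _.
    rewrite big_cons /word_eval big_cons /=.
    move: (\prod_(i <- w) _) (\prod_(i <- ps) _) => u v; ring.
  by rewrite !IHps ?mulr0 ?subr0// ltnW.
(* A product vanishing on [s] except at [x] isolates the term [c x]. *)
move=> x xs; have [|ps [szps psx ps0]] := @separating_product x (rem x s).
  by rewrite mem_rem_uniqF.
have := Mps ps [::]; rewrite szps size_rem// add0n leq_pred => /(_ isT).
rewrite (bigD1_seq x)//= [X in _ + X]big1_seq ?addr0.
  rewrite /word_eval big_nil mul1r => /eqP; rewrite mulf_eq0 (negPf psx) orbF.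
  by move/eqP.
move=> y /andP[yx ys]; rewrite ps0 ?mulr0// mem_rem_uniq// inE yx//.
Qed.

(** The difference [c - d] lives on at most [size s + size t] points, so [moments_eq0] applies to
    it. *)
Lemma moments_inj s t c d : uniq s -> uniq t ->
  (forall x, (x \in s) = (c x != 0)) -> (forall x, (x \in t) = (d x != 0)) ->
  (forall w, (size w <= size s + size t)%N -> moment s c w = moment t d w) ->
  s =i t /\ c = d.
Proof.
move=> us ut cs dt Mst.
have sum_undup (r : seq X) (e h : X -> F) : uniq r -> {subset r <= s ++ t} ->
    (forall x, (x \in r) = (e x != 0)) ->
    \sum_(x <- undup (s ++ t)) e x * h x = \sum_(x <- r) e x * h x.
  move=> ur rst er.
  rewrite [LHS](bigID (mem r))/= [X in _ + X]big1 ?addr0; last first.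
    by move=> x; rewrite er negbK => /eqP ->; rewrite mul0r.
  rewrite -big_filter; apply: perm_big; apply: uniq_perm => //.
    by rewrite filter_uniq ?undup_uniq.
  move=> x; rewrite mem_filter mem_undup; case xr: (x \in r) => //=.
  exact: rst.
have cd : c = d.
  apply: funext => x; apply/eqP; rewrite -subr_eq0.
  have [xst|] := boolP (x \in undup (s ++ t)); last first.
    rewrite mem_undup mem_cat negb_or cs dt !negbK => /andP[/eqP -> /eqP ->].
    by rewrite subrr.
  apply/eqP; apply: (@moments_eq0 _ (fun x => c x - d x) _ _ x xst).
    exact: undup_uniq.
  move=> w /leq_trans/(_ (size_undup _)); rewrite size_cat => /Mst Mw.
  rewrite /moment; under eq_bigr do rewrite mulrBl.
  rewrite sumrB (sum_undup s)// ?(sum_undup t)//.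
  - by apply/eqP; rewrite subr_eq0; apply/eqP.
  - by move=> y yt; rewrite mem_cat yt orbT.
  - by move=> y ys; rewrite mem_cat ys.
by split=> // x; rewrite cs dt cd.
Qed.

(** By [moments_eq0], short words over the finitely many letters alive on [s] give a matrix of full
    column rank; [size s] independent rows are then selected. *)
Lemma word_matrix_unit s : uniq s ->
  finite_set [set g | exists2 x, x \in s & f g x != 0] ->
  exists2 W, size W = size s /\ (forall w, w \in W -> (size w <= size s)%N) &
    word_matrix (size s) W s \in unitmx.
Proof.
move=> us /(finite_set_bounded_seqs (size s))/finite_seqP[ws wsE].
have ws_size w : w \in ws -> (size w <= size s)%N.
  by move=> ww; have : [set` ws] w by []; rewrite -wsE => -[].
have full : row_full (word_matrix (size ws) ws s).
  rewrite /row_full -mxrank_tr; apply: inj_row_free => v v0.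
  apply/rowP => j; rewrite mxE.
  (* The vector [v] read as weights on [X]; the default [j] only affects points outside [s], which
     no moment sees. *)
  pose c x : F := v ord0 (insubd j (index x s)).
  have cE k : c (tnth (in_tuple s) k) = v ord0 k.
    rewrite /c; congr (v _ _); apply: val_inj; rewrite val_insubd.
    by rewrite (tnth_nth (tnth (in_tuple s) j)) index_uniq//= ltn_ord.
  rewrite -cE; apply: (moments_eq0 us _ (mem_tnth j (in_tuple s))) => w wm.
  have [ww|wNw] := boolP (w \in ws).
    have iw : (index w ws < size ws)%N by rewrite index_mem.
    have /matrixP/(_ ord0 (Ordinal iw)) := v0; rewrite !mxE => <-.
    rewrite /moment big_tnth; apply: eq_bigr => k _.
    by rewrite cE !mxE/= nth_index.
  apply/eqP/negPn/negP => /moment_neq0[x xs wx].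
  have : [set` ws] w.
    by rewrite -wsE; split=> // g gw; exists x => //; exact: wx.
  by rewrite /= (negPf wNw).
exists [seq nth [::] ws (fullrankfun full i) | i <- enum 'I_(size s)].
  rewrite size_map size_enum_ord; split=> // _ /mapP[i _ ->].
  by apply: ws_size; rewrite mem_nth.
rewrite (_ : word_matrix _ _ _ =
    rowsub (fullrankfun full) (word_matrix _ ws s)).
  exact: fullrowsub_unit.
apply/matrixP => i j; rewrite !mxE (nth_map i) ?size_enum_ord//.
by rewrite nth_ord_enum.
Qed.

Lemma moment_det_exists s c : uniq s ->
  finite_set [set g | exists2 x, x \in s & f g x != 0] ->
  (forall x, x \in s -> c x != 0) ->
  exists W, [/\ size W = size s, forall w, w \in W -> (size w <= size s)%N &
    moment_det (moment s c) W != 0].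
Proof.
move=> us /(word_matrix_unit us)[W [szW sW] WU] cs.
exists W; split=> //; rewrite /moment_det szW moment_matrixE !det_mulmx det_tr.
rewrite det_diag !mulf_neq0 -?unitfE -?unitmxE//.
by rewrite unitfE; apply/prodf_neq0 => i _; rewrite mxE cs// mem_tnth.
Qed.

End moments.

(** * Transfer of the separating family from [K] to [L] *)

Lemma dense_range_separates (R : realType) (L : topologicalType) (I : Type)
    (phi : I -> Cp R L) : tychonoff_space L -> dense (range phi) ->
  forall x y, (forall i, Cp_fun (phi i) x = Cp_fun (phi i) y) -> x = y.
Proof.
move=> tychL dphi x y xy; apply/eqP/negPn/negP => /negP xNy.
have [|e [ex ey]] := @Cp_separate_finite R L tychL [:: y] x.
  by rewrite inE; apply/negP.
(* This open set contains a function separating [x] from [y], so it meets the dense range. *)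
pose O := [set h : Cp R L | 0 < Cp_fun h x - Cp_fun h y].
have [||h [Oh [i _ hE]]] := dphi O.
- by exists e; rewrite /O /= ex ey ?mem_head// subr0 ltr01.
- have : continuous (fun h : Cp R L => Cp_fun h x - Cp_fun h y).
    move=> h.
    exact: cvgB (@Cp_eval_continuous R L x h) (@Cp_eval_continuous R L y h).
  by move=> /continuousP/(_ _ (@open_gt R 0)).
- by move: Oh; rewrite /O /= -hE xy subrr ltxx.
Qed.

Lemma moment_det_continuous (R : realType) (T : topologicalType)
    (Gamma : choiceType) (M : T -> seq Gamma -> R) (W : seq (seq Gamma)) :
  (forall w, continuous (M^~ w)) -> continuous (fun y => moment_det (M y) W).
Proof.
move=> Mc; rewrite /moment_det /determinant.
apply: (continuous_big add_continuous) => u _ y.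
apply: cvgM; first exact: cvg_cst.
apply: (continuous_big mul_continuous) => i _.
rewrite (_ : (fun z => _) = M^~ (nth [::] W i ++ nth [::] W (u i))).
  exact: Mc.
by apply: funext => z; rewrite mxE.
Qed.

Theorem theorem5p12 (R : realType) (K L : topologicalType)
    (tychK : tychonoff_space K) (tychL : tychonoff_space L)
    (cptK : compact [set: K]) (cptL : compact [set: L])
    (hphi : exists phi : {linear Cp R K -> Cp R L},
        continuous phi /\ dense (range phi)) :
  omega_Corson_compact R K -> omega_Corson_compact R L.
Proof.
case: hphi => phi [phic phid].
move=> /omega_Corson_compact_coordinates[Gamma [f [fc ffin fsep]]].
have wc (w : seq Gamma) : continuous (word_eval f w).
  by apply: (continuous_big mul_continuous) => g _; exact: fc.
pose M y w := Cp_fun (phi (mkcts (wc w) : continuousType K R)) y.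
have Mc w : continuous (M^~ w) by exact: Cp_fun_continuous.
have /choice[s /choice[c scP]] y : exists s c, [/\ uniq s,
    forall x, (x \in s) = (c x != 0) &
    forall h, Cp_fun (phi h) y = \sum_(x <- s) c x * Cp_fun h x].
  apply: (Cp_functional_finite_support tychK
    (psi := fun h => Cp_fun (phi h) y)).
    by move=> a g h; rewrite linearP.
  move=> h; apply: (@continuous_comp _ _ _ phi (fun k : Cp R L => Cp_fun k y)).
    exact: phic.
  exact: Cp_eval_continuous.
have ME y : M y = moment f (s y) (c y).
  by apply: funext => w; have [_ _ phiE] := scP y; exact: phiE.
pose B y := [set g | exists2 x, x \in s y & f g x != 0].
have Bfin y : finite_set (B y).
  have -> : B y = \bigcup_(x in [set` s y]) [set g | f g x != 0].
    by apply/seteqP; split=> g [x xs fgx]; exists x.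
  by apply: bigcup_finite => // x _; exact: ffin.
(* [None] stands for the determinant alone and [Some w] for its product with [M_w]; indices breaking
   the length bounds get the zero function. *)
pose G (i : seq (seq Gamma) * option (seq Gamma)) : L -> R :=
  if all (fun w => size w <= size i.1)%N i.1 &&
     (oapp size 0 i.2 <= (size i.1).*2)%N
  then fun y => moment_det (M y) i.1 * oapp (M y) 1 i.2 else cst 0.
apply: (omega_Corson_compact_family (f := G) cptL).
- move=> [W o]; rewrite /G /=; case: ifP => _ y; last exact: cvg_cst.
  apply: cvgM; first exact: moment_det_continuous.
  by case: o => [w|] /=; [exact: Mc|exact: cvg_cst].
(* A nonzero determinant forces [size W <= n], so every word involved has bounded length over the
   finite alphabet [B y]. *)
- move=> y; pose n := size (s y).
  pose words m := [set w | (size w <= m)%N /\ forall g, g \in w -> B y g].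
  apply: (@sub_finite_set _ _
    ([set W : seq (seq Gamma) |
        (size W <= n)%N /\ forall w, w \in W -> words n w]
     `*` ([set None] `|` [set Some w | w in words n.*2]))); last first.
    apply: finite_setX.
      exact/finite_set_bounded_seqs/finite_set_bounded_seqs.
    rewrite finite_setU; split; first exact: finite_set1.
    exact/finite_image/finite_set_bounded_seqs.
  move=> [W o]; rewrite /G /=.
  case: ifP => [/andP[/allP sW so]|_]; last by rewrite /cst eqxx.
  rewrite mulf_eq0 negb_or => /andP[].
  rewrite ME => DW Mo; have Wn := moment_det_size DW.
  split=> /=.
    split=> // w wW; split; first exact: leq_trans (sW _ wW) Wn.
    by move=> g; exact: (moment_det_letters DW wW).
  case: o so Mo => [w|_ _] /=; last by left.
  move=> wW /moment_neq0[x xs wx]; right; exists w => //; split.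
    by apply: leq_trans wW _; rewrite leq_double.
  by move=> g gw; exists x => //; exact: wx.
(* A determinant nonzero at the point with more atoms is nonzero at the other too, which forces
   equal numbers of atoms. *)
move=> x y; wlog xy : x y / (size (s x) <= size (s y))%N.
  move=> H Gxy; have /orP[/H|/H H'] := leq_total (size (s x)) (size (s y)).
    exact.
  by rewrite H'.
move=> Gxy; have [ux cx phix] := scP x; have [uy cy phiy] := scP y.
have [|W [szW sW DW]] := moment_det_exists fsep uy (Bfin y) (c := c y).
  by move=> z; rewrite cy.
have allW : all (fun w => size w <= size W)%N W.
  by apply/allP => w /sW; rewrite szW.
have Dxy : moment_det (M x) W = moment_det (M y) W.
  by have := Gxy (W, None); rewrite /G /= allW /= !mulr1.
have sxy : size (s x) = size (s y).
  apply/eqP; rewrite eqn_leq xy -szW; apply: (@moment_det_size _ _ _ f _ (c x)).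
  by rewrite -ME Dxy ME.
(* The bound equals twice [size W], so [Some w] is admissible and the common nonzero determinant
   cancels. *)
have Mxy w : (size w <= size (s x) + size (s y))%N -> M x w = M y w.
  rewrite sxy addnn -szW => wW; have := Gxy (W, Some w).
  by rewrite /G /= allW wW /= Dxy => /mulfI; apply; rewrite ME.
have [] := moments_inj fsep ux uy cx cy.
  by move=> w /Mxy; rewrite !(ME _).
move=> sE cE; apply: (dense_range_separates tychL phid) => h.
by rewrite phix phiy cE; apply: perm_big; exact: uniq_perm.
Qed.
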